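(* Let $R$ be a commutative ring with identity, let $M$ be an $R$-module and let $N$ be a submodule of $M$ with $N\subseteq J(R)M$. Then: (a) $N$ is a quasi $J$-submodule of $M$ if and only if $M/N$ is a non-zero quasi $J$-presimplifiable $R$-module. (b) $N$ is a $J$-submodule of $M$ if and only if $M/N$ is a non-zero $J$-presimplifiable $R$-module.
   Context: All rings are commutative with identity and all modules are unital. $J(R)$ is the Jacobson radical of $R$. For a submodule $N$ of an $R$-module $M$, $(N:M)=\{r\in R: rM\subseteq N\}$. A proper submodule $P$ of $M$ is prime if $rm\in P$ ($r\in R$, $m\in M$) implies $m\in P$ or $r\in(P:M)$. $M\text{-}rad(N)$ is the intersection of all prime submodules of $M$ containing $N$ (an empty intersection being $M$). A proper submodule $N$ of $M$ is a $J$-submodule if whenever $r\in R$, $m\in M$ with $rm\in N$ and $r\notin (J(R)M:M)$, then $m\in N$. A proper submodule $N$ of $M$ is a quasi $J$-submodule if whenever $r\in R$, $m\in M$ with $rm\in N$ and $r\notin (J(R)M:M)$, then $m\in M\text{-}rad(N)$. For an $R$-module $M$, $Nil(M)$ is the intersection of all prime submodules of $M$ (an empty intersection being $M$), $Z(M)=\{r\in R: rm=0 \text{ for some } 0\neq m\in M\}$ and $NZ(M)=\{r\in R: rm=0\text{ for some } m\in M,\ m\notin Nil(M)\}$. $M$ is called $J$-presimplifiable if $Z(M)\subseteq (J(R)M:M)$, and quasi $J$-presimplifiable if $NZ(M)\subseteq (J(R)M:M)$. *)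

(* Defs.v *)
From HB Require Import structures.
From mathcomp Require Import all_boot all_order all_algebra.
From mathcomp Require Import generic_quotient ring_quotient.
From mathcomp Require Import boolp classical_sets.

Set Implicit Arguments.
Unset Strict Implicit.
Unset Printing Implicit Defensive.

Import GRing.Theory Quotient.

Local Open Scope classical_set_scope.
Local Open Scope ring_scope.
Local Open Scope quotient_scope.

(* Submodules are MathComp's bundled predicates [submodClosed M], and ideals
   are submodules of the regular module [R^o].  These predicates are boolean;
   [submodClosed_of_set] shows that, classically, no submodule is missed. *)
Lemma submodClosed_of_set (R : pzRingType) (M : lmodType R) (S : set M) :
  S 0 -> (forall a u v, S u -> S v -> S (a *: u + v)) ->
  exists N : submodClosed M, [set` N] = S.
Proof.
move=> S0 Slin; pose p : M -> bool := fun x => `[< S x >].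
have pP : submod_closed (p : {pred M}).
  split=> [|a u v /asboolP Su /asboolP Sv]; apply/asboolP => //.
  exact: Slin.
pose pI := GRing.isSubmodClosed.Build R M p (GRing.submod_closed_semi pP).
pose N : submodClosed M := HB.pack p pI.
exists N; apply/seteqP; split=> x /=; first by move/asboolP.
by move=> Sx; apply/asboolP.
Qed.

(* [submodClosed] does not record closure under opposite, which [{quot N}]
   requires. *)
Lemma submodClosed_opp (R : pzRingType) (M : lmodType R) (N : submodClosed M) :
  oppr_closed (N : {pred M}).
Proof. by move=> x Nx; rewrite -scaleN1r rpredZ. Qed.

Definition submod_zmodClosed (R : pzRingType) (M : lmodType R)
    (N : submodClosed M) : zmodClosed M :=
  HB.pack (GRing.SubmodClosed.sort N)
    (GRing.isOppClosed.Build M (GRing.SubmodClosed.sort N)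
       (submodClosed_opp (N := N))).

Section QuotientModule.
Variables (R : pzRingType) (M : lmodType R) (N : submodClosed M).

Definition quot_module : Type := {quot (submod_zmodClosed N)}.

HB.instance Definition _ := GRing.Zmodule.on quot_module.
HB.instance Definition _ := EqQuotient.on quot_module.

Definition scaleq (a : R) : quot_module -> quot_module :=
  lift_op1 quot_module ( *:%R a).

Lemma pi_scaleq (a : R) : {morph \pi_quot_module : x / a *: x >-> scaleq a x}.
Proof.
move=> x; unlock scaleq; apply/eqP; rewrite piE equivE -scalerBr.
apply: (@rpredZ _ _ N).
by rewrite -[_ \in _]/(equiv (submod_zmodClosed N) _ _) equivE idealrBE reprK.
Qed.

Lemma pi_quotD : {morph \pi_quot_module : x y / x + y}.
Proof. exact: pi_add. Qed.

Fact scaleqA a b x : scaleq a (scaleq b x) = scaleq (a * b) x.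
Proof. by rewrite -[x]reprK -!pi_scaleq scalerA. Qed.

Fact scale1q : left_id 1 scaleq.
Proof. by move=> x; rewrite -[x]reprK -!pi_scaleq scale1r. Qed.

Fact scaleqDr : right_distributive scaleq +%R.
Proof.
move=> a x y; rewrite -[x]reprK -[y]reprK.
by rewrite -pi_quotD -!pi_scaleq -pi_quotD scalerDr.
Qed.

Fact scaleqDl x : {morph scaleq^~ x : a b / a + b}.
Proof. by move=> a b; rewrite -[x]reprK -!pi_scaleq -pi_quotD scalerDl. Qed.

HB.instance Definition _ :=
  GRing.Zmodule_isLmodule.Build R quot_module scaleqA scale1q scaleqDr scaleqDl.

Lemma pi_quotZ (a : R) : {morph \pi_quot_module : x / a *: x}.
Proof. exact: pi_scaleq. Qed.

Lemma pi_quot_eq0 (x : M) : (\pi_quot_module x == 0) = (x \in N).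
Proof.
rewrite -[x in RHS]subr0 -[RHS]/(equiv (submod_zmodClosed N) x 0) equivE.
have <- : \pi_quot_module 0 = 0.
  by rewrite -(addrK (\pi 0) (\pi 0)) -pi_quotD addr0 subrr.
by rewrite idealrBE.
Qed.

End QuotientModule.

Section Submodules.
Variables (R : comPzRingType) (M : lmodType R).

Definition proper_submodule (N : submodClosed M) : Prop :=
  exists m : M, m \notin N.

Definition residual (A : set M) : set R :=
  [set r | forall m : M, A (r *: m)].

Definition prime_submodule (P : submodClosed M) : Prop :=
  proper_submodule P /\
  forall (r : R) (m : M), r *: m \in P -> m \in P \/ residual [set` P] r.

Definition M_rad (N : submodClosed M) : set M :=
  [set x | forall P : submodClosed M,
     prime_submodule P -> [set` N] `<=` [set` P] -> x \in P].

Definition Nil_submodule : set M :=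
  [set x | forall P : submodClosed M, prime_submodule P -> x \in P].

Definition ideal_mul (I : set R) : set M :=
  [set x | exists (n : nat) (a : 'I_n -> R) (m : 'I_n -> M),
     (forall i, I (a i)) /\ x = \sum_(i < n) a i *: m i].

End Submodules.

Arguments Nil_submodule {R} M.
Arguments ideal_mul {R} M I.

Definition maximal_ideal (R : comPzRingType) (I : submodClosed R^o) : Prop :=
  proper_submodule I /\
  forall K : submodClosed R^o, proper_submodule K ->
    [set` I] `<=` [set` K] -> [set` K] = [set` I].

Definition jacobson_radical (R : comPzRingType) : set R :=
  [set r | forall I : submodClosed R^o, maximal_ideal I -> (r : R^o) \in I].

Arguments jacobson_radical R : clear implicits.

Section JSubmodules.
Variables (R : comPzRingType) (M : lmodType R).

Definition JM : set M := ideal_mul M (jacobson_radical R).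

Definition J_submodule (N : submodClosed M) : Prop :=
  proper_submodule N /\
  forall (r : R) (m : M), r *: m \in N -> ~ residual JM r -> m \in N.

Definition quasi_J_submodule (N : submodClosed M) : Prop :=
  proper_submodule N /\
  forall (r : R) (m : M), r *: m \in N -> ~ residual JM r -> M_rad N m.

Definition zero_divisors : set R :=
  [set r | exists m : M, m != 0 /\ r *: m = 0].

Definition non_nil_zero_divisors : set R :=
  [set r | exists m : M, ~ Nil_submodule M m /\ r *: m = 0].

Definition J_presimplifiable : Prop := zero_divisors `<=` residual JM.

Definition quasi_J_presimplifiable : Prop :=
  non_nil_zero_divisors `<=` residual JM.

Definition nonzero_module : Prop := exists m : M, m != 0.

End JSubmodules.

Arguments JM {R} M.
Arguments zero_divisors {R} M.
Arguments non_nil_zero_divisors {R} M.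
Arguments J_presimplifiable {R} M.
Arguments quasi_J_presimplifiable {R} M.
Arguments nonzero_module {R} M.

(* Main.v *)
(* Since [N] lies in [J(R)M], an element of [M] is in [J(R)M] iff its class is
   in [J(R)(M/N)], so [M] and [M/N] have the same residual [(J(R)M : M)].
   Moreover the prime submodules of [M/N] correspond to the prime submodules of
   [M] containing [N], so [Nil(M/N)] is the image of [M-rad(N)].  Both
   equivalences are then the translation of [r *: m \in N] into
   [r *: \pi m = 0]. *)

Require Import Defs.
From HB Require Import structures.
From mathcomp Require Import all_boot all_order all_algebra.
From mathcomp Require Import generic_quotient ring_quotient.
From mathcomp Require Import boolp classical_sets.

Set Implicit Arguments.
Unset Strict Implicit.
Unset Printing Implicit Defensive.

Import GRing.Theory Quotient.

Local Open Scope classical_set_scope.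
Local Open Scope ring_scope.

(** Concatenate the two finite families: [split] sends an index below [n + p] to the family it comes
    from. *)
Lemma ideal_mulD (R : comPzRingType) (M : lmodType R) (I : set R) (x y : M) :
  ideal_mul M I x -> ideal_mul M I y -> ideal_mul M I (x + y).
Proof.
move=> [n [a [m [Ia ->]]]] [p [b [l [Ib ->]]]].
exists (n + p)%N, (fun i => match split i with inl j => a j | inr j => b j end),
  (fun i => match split i with inl j => m j | inr j => l j end).
split=> [i|]; first by case: (split i).
rewrite big_split_ord; congr (_ + _); apply: eq_bigr => i _.
  by rewrite (unsplitK (inl i)).
by rewrite (unsplitK (inr i)).
Qed.

Section QuotientModuleTheory.
Variables (R : comPzRingType) (M : lmodType R) (N : submodClosed M).

Local Notation pi := (\pi_(quot_module N)%qT : M -> quot_module N).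

Lemma pi_quot_surj (y : quot_module N) : exists x, y = pi x.
Proof. by exists (repr y); rewrite reprK. Qed.

Lemma pi_quot0 : pi 0 = 0.
Proof. by apply/eqP; rewrite pi_quot_eq0 rpred0. Qed.

Lemma pi_quot_sum n (F : 'I_n -> M) : pi (\sum_i F i) = \sum_i pi (F i).
Proof. exact: (big_morph pi (@pi_quotD _ _ N) pi_quot0). Qed.

Lemma pi_quot_eq (x y : M) : pi x = pi y -> x - y \in N.
Proof.
move=> xy; rewrite -pi_quot_eq0 -scaleN1r pi_quotD pi_quotZ xy.
by rewrite scaleN1r subrr.
Qed.

Lemma nonzero_quot_module :
  nonzero_module (quot_module N) <-> proper_submodule N.
Proof.
split=> [[y]|[m mN]]; last by exists (pi m); rewrite pi_quot_eq0.
by have [x ->] := pi_quot_surj y; rewrite pi_quot_eq0; exists x.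
Qed.

Lemma JM_quot (x : M) : [set` N] `<=` JM M ->
  JM (quot_module N) (pi x) <-> JM M x.
Proof.
move=> NJ; split=> [[n [a [y [Ja pix]]]]|[n [a [m [Ja ->]]]]].
  have piy i : pi (repr (y i)) = y i by rewrite reprK.
  (* Lifting the expression of [pi x] through representatives gives an element of [J(R)M] with the
     same class as [x]; the difference lies in [N], hence in [J(R)M]. *)
  rewrite -[x](subrK (\sum_i a i *: repr (y i))).
  apply: ideal_mulD; last by exists n, a, (fun i => repr (y i)).
  apply/NJ/pi_quot_eq; rewrite pix pi_quot_sum.
  by apply: eq_bigr => i _; rewrite pi_quotZ piy.
exists n, a, (fun i => pi (m i)); split=> //.
by rewrite pi_quot_sum; apply: eq_bigr => i _; rewrite pi_quotZ.
Qed.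

Lemma residual_JM_quot : [set` N] `<=` JM M ->
  residual (JM (quot_module N)) = residual (JM M).
Proof.
move=> NJ; apply/seteqP; split=> r /= rJ.
  by move=> m; apply/JM_quot => //; rewrite pi_quotZ; apply: rJ.
move=> y; have [x ->] := pi_quot_surj y.
by rewrite -pi_quotZ; apply/JM_quot.
Qed.

(** The hypothesis makes [P] the preimage of [Q], so one statement serves both for pulling [Q] back
    and for pushing [P] forward. *)
Lemma prime_submodule_quot (P : submodClosed M)
    (Q : submodClosed (quot_module N)) :
  (forall x, (pi x \in Q) = (x \in P)) ->
  prime_submodule Q <-> prime_submodule P.
Proof.
move=> QP.
have rQP r : residual [set` Q] r <-> residual [set` P] r.
  split=> rP m /=; first by rewrite -QP pi_quotZ; apply: rP.
  have [x ->] := pi_quot_surj m.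
  by rewrite -pi_quotZ QP; apply: rP.
split=> -[[m mP] Pprime]; split.
- by have [x mx] := pi_quot_surj m; exists x; rewrite -QP -mx.
- move=> r x; rewrite -!QP pi_quotZ => /Pprime[?|/rQP ?]; by [left|right].
- by exists (pi m); rewrite QP.
move=> r y; have [x ->] := pi_quot_surj y.
rewrite -pi_quotZ !QP => /Pprime[?|/rQP ?]; by [left|right].
Qed.

Lemma submodule_preim_quot (Q : submodClosed (quot_module N)) :
  exists P : submodClosed M, forall x, (pi x \in Q) = (x \in P).
Proof.
have [||P PE] := @submodClosed_of_set R M [set x | pi x \in Q].
- by rewrite /= pi_quot0 rpred0.
- by move=> a u v /= Qu Qv; rewrite pi_quotD pi_quotZ rpredD ?rpredZ.
exists P => x; apply/idP/idP => Hx.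
  by have : [set` P] x by rewrite PE.
by have : [set x | pi x \in Q] x by rewrite -PE.
Qed.

Lemma submodule_image_quot (P : submodClosed M) : [set` N] `<=` [set` P] ->
  exists Q : submodClosed (quot_module N), forall x, (pi x \in Q) = (x \in P).
Proof.
move=> NP.
have [||Q QE] :=
    @submodClosed_of_set R (quot_module N) (pi @` [set` P]).
- by exists 0; [exact: rpred0|exact: pi_quot0].
- move=> a _ _ [u /= Pu <-] [v /= Pv <-]; exists (a *: u + v) => /=.
    by rewrite rpredD ?rpredZ.
  by rewrite pi_quotD pi_quotZ.
exists Q => x; apply/idP/idP => Hx; last first.
  by have : [set` Q] (pi x) by rewrite QE; exists x.
have : (pi @` [set` P]) (pi x) by rewrite -QE.
(* Since [P] contains [N], it is a union of cosets of [N]: [x] differs from [u] in [P] by an element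
   of [N]. *)
move=> [u /= Pu /esym/pi_quot_eq /NP /= Pxu].
by rewrite -(subrK u x) rpredD.
Qed.

Lemma Nil_quot (x : M) : Nil_submodule (quot_module N) (pi x) <-> M_rad N x.
Proof.
split=> [nx P Pprime /submodule_image_quot[Q QP]|rx Q Qprime].
  by rewrite -QP; apply/nx/(prime_submodule_quot QP).
have [P QP] := submodule_preim_quot Q.
rewrite QP; apply: rx; first exact/(prime_submodule_quot QP).
(* The preimage [P] contains [N], because [pi] sends [N] to [0], which lies in [Q]. *)
by move=> y /=; rewrite -pi_quot_eq0 -QP => /eqP ->; rewrite rpred0.
Qed.

End QuotientModuleTheory.

Theorem theorem1 (R : comPzRingType) (M : lmodType R) (N : submodClosed M)
    (NJ : [set` N] `<=` JM M) :
  (quasi_J_submodule N <->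
     nonzero_module (quot_module N) /\ quasi_J_presimplifiable (quot_module N)) /\
  (J_submodule N <->
     nonzero_module (quot_module N) /\ J_presimplifiable (quot_module N)).
Proof.
have eq0 r m : r *: m \in N <-> r *: (\pi_(quot_module N)%qT m : quot_module N) = 0.
  by rewrite -pi_quotZ -pi_quot_eq0; split=> /eqP.
(* From here on, both sides of each equivalence refer to the same residual, that of [JM M]. *)
rewrite /quasi_J_presimplifiable /J_presimplifiable residual_JM_quot //.
split; split=> [[Nproper Nprop]|[Mnonzero Mprop]];
  (split; first exact/nonzero_quot_module).
- move=> r [y]; have [x ->] := pi_quot_surj y => -[nx /eq0 rx].
  (* Were [r] outside the residual, [x] would lie in [M_rad N], so [pi x] in [Nil(M/N)], against
     [nx]. *)
  by apply: contrapT => /(Nprop _ _ rx)/Nil_quot.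
- move=> r m /eq0 rm rJ; apply: contrapT => mN.
  (* If [m] is outside [M_rad N], its class witnesses that [r] is in [NZ(M/N)], which contradicts
     [rJ]. *)
  by apply/rJ/Mprop; exists (\pi_(quot_module N)%qT m); split=> // /Nil_quot.
- move=> r [y]; have [x ->] := pi_quot_surj y.
  rewrite pi_quot_eq0 => -[xN /eq0 rx].
  by apply: contrapT => /(Nprop _ _ rx); apply/negP.
move=> r m /eq0 rm rJ; apply: contrapT => /negP mN.
by apply/rJ/Mprop; exists (\pi_(quot_module N)%qT m); rewrite pi_quot_eq0.
Qed.
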